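(* Let $\alpha_0,\alpha_1,\alpha_2,\alpha_3$ be complex parameters with $\alpha_0+\alpha_1+2\alpha_2+2\alpha_3=1$, and consider the system $$\frac{dx}{dt}=\frac{-2x^3y+2x^2y-(\alpha_1+2\alpha_2)x^2-(t-1+2\alpha_3)x+t}{t},$$ $$\frac{dy}{dt}=\frac{3x^2y^2-2xy^2+2(\alpha_1+2\alpha_2)xy+(t-1+2\alpha_3)y+(\alpha_1+\alpha_2)\alpha_2}{t}.$$ This system admits extended affine Weyl group symmetry of type $B_3^{(1)}$ as a group of Bäcklund transformations, with generators acting on $(x,y,t;\alpha_0,\alpha_1,\alpha_2,\alpha_3)$ by \begin{align*} s_0:&\ \to \left(x,\,y-\tfrac{\alpha_0}{x-1},\,t;\,-\alpha_0,\alpha_1,\alpha_2+\alpha_0,\alpha_3\right),\\ s_1:&\ \to (x,\,y,\,t;\,\alpha_0,-\alpha_1,\alpha_2+\alpha_1,\alpha_3),\\ s_2:&\ \to \left(x+\tfrac{\alpha_2}{y},\,y,\,t;\,\alpha_0+\alpha_2,\alpha_1+\alpha_2,-\alpha_2,\alpha_3+\alpha_2\right),\\ s_3:&\ \to \left(x,\,y-\tfrac{2\alpha_3}{x}+\tfrac{t}{x^2},\,-t;\,\alpha_0,\alpha_1,\alpha_2+2\alpha_3,-\alpha_3\right),\\ \pi:&\ \to \left(\tfrac{x}{x-1},\,-(x-1)((x-1)y+\alpha_2),\,-t;\,\alpha_1,\alpha_0,\alpha_2,\alpha_3\right). \end{align*} That is: each of $s_0,s_1,s_2,s_3,\pi$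 is a Bäcklund transformation of the system; the group generated by $s_0,s_1,s_2,s_3$ is the affine Weyl group of type $B_3^{(1)}$ with these as simple reflections ($s_i^2=1$, $(s_0s_1)^2=(s_0s_3)^2=(s_1s_3)^2=1$, $(s_0s_2)^3=(s_1s_2)^3=1$, $(s_2s_3)^4=1$ are defining relations); and $\pi$ realizes the diagram automorphism: $\pi^2=1$, $\pi s_0=s_1\pi$, $\pi s_2=s_2\pi$, $\pi s_3=s_3\pi$.
   Context: A transformation $(x,y,t;\alpha)\mapsto(x',y',t';\alpha')$, with $x',y',t'$ rational in $x,y,t,\alpha$, is a Bäcklund transformation of the system if, whenever $(x(t),y(t))$ solves the system with parameters $\alpha$, the pair $(x',y')$, viewed as a function of the independent variable $t'$ (where defined), solves the same system with parameters $\alpha'$. Such transformations are composed as automorphisms of the field of rational functions in $x,y,t$ and the parameters (subject to their linear relation): e.g. $s_0(y)=y-\alpha_0/(x-1)$, $s_0(\alpha_2)=\alpha_2+\alpha_0$. *)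

(* Defs.v *)
From HB Require Import structures.
From mathcomp Require Import all_boot all_order all_algebra.
From mathcomp Require Import generic_quotient.
From mathcomp Require Import boolp classical_sets reals topology normedtype derive.
From mathcomp Require Import complex.
(* The notations of mpoly are incompatible with those of mathcomp-analysis. *)
From mathcomp Require Import -(notations) mpoly.

Set Implicit Arguments.
Unset Strict Implicit.
Unset Printing Implicit Defensive.

Import Order.TTheory GRing.Theory Num.Theory numFieldNormedType.Exports.

Local Open Scope classical_set_scope.
Local Open Scope ring_scope.

(* The type annotation is what makes the topology and the derivatives that
   mathcomp-analysis puts on every numFieldType available on R[i]. *)
Definition cplx (R : realType) : numFieldType := R[i].

Record params (K : Type) := Params { al0 : K; al1 : K; al2 : K; al3 : K }.

Record datum (K : Type) :=
  Datum { cx : K; cy : K; ct : K; cpar : params K }.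

Definition balanced (K : nzRingType) (a : params K) : Prop :=
  al0 a + al1 a + 2 * al2 a + 2 * al3 a = 1.

(* alpha_0 is omitted: by the linear relation it is determined by the rest. *)
Definition coords (K : nzRingType) (p : datum K) : 'I_6 -> K :=
  fun i => nth 0 [:: cx p; cy p; ct p; al1 (cpar p); al2 (cpar p); al3 (cpar p)] i.

Section RationalFunctions.
Variable R : realType.
Notation C := (cplx R).

(* The field of rational functions in x, y, t and the parameters subject to
   their linear relation, as the purely transcendental extension
   C(x, y, t, alpha_1, alpha_2, alpha_3). *)
Definition ratfun : fieldType := {fraction (mpoly 6 C)}.

Definition cst (c : C) : ratfun := tofrac (mpolyC 6 c).

Definition var (k : nat) : ratfun := tofrac (mpolyX C (mnm1 (inord k : 'I_6))).

Definition X : ratfun := var 0.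
Definition Y : ratfun := var 1.
Definition T : ratfun := var 2.
Definition A1 : ratfun := var 3.
Definition A2 : ratfun := var 4.
Definition A3 : ratfun := var 5.
Definition A0 : ratfun := 1 - A1 - 2 * A2 - 2 * A3.

(* f is defined at the point v, with value c. *)
Definition value_at (f : ratfun) (v : datum C) (c : C) : Prop :=
  exists p q : mpoly 6 C,
    [/\ f = tofrac p / tofrac q, meval (coords v) q != 0
      & c = meval (coords v) p / meval (coords v) q].

(* A transformation (x,y,t;alpha) |-> (x',y',t';alpha') is the datum of the
   rational functions x', y', t', alpha'; maps_to F v w says that it is defined
   at v and sends v to w. *)
Definition maps_to (F : datum ratfun) (v w : datum C) : Prop :=
  [/\ value_at (cx F) v (cx w),
      value_at (cy F) v (cy w) &
      value_at (ct F) v (ct w)] /\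
  [/\ value_at (al0 (cpar F)) v (al0 (cpar w)),
      value_at (al1 (cpar F)) v (al1 (cpar w)),
      value_at (al2 (cpar F)) v (al2 (cpar w)) &
      value_at (al3 (cpar F)) v (al3 (cpar w))].

Definition rhs_x (a : params C) (x y t : C) : C :=
  (- 2 * x ^+ 3 * y + 2 * x ^+ 2 * y - (al1 a + 2 * al2 a) * x ^+ 2
   - (t - 1 + 2 * al3 a) * x + t) / t.

Definition rhs_y (a : params C) (x y t : C) : C :=
  (3 * x ^+ 2 * y ^+ 2 - 2 * x * y ^+ 2 + 2 * (al1 a + 2 * al2 a) * x * y
   + (t - 1 + 2 * al3 a) * y + (al1 a + al2 a) * al2 a) / t.

Definition solves (a : params C) (U : set C) (x y : C -> C) : Prop :=
  [/\ balanced a, open U, (forall t, U t -> t != 0) &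
      forall t, U t ->
        is_derive t (1 : C) x (rhs_x a (x t) (y t) t) /\
        is_derive t (1 : C) y (rhs_y a (x t) (y t) t)].

(* theta is t' as a function of t, and xi, eta are x', y' as functions of t';
   W is an open set on which the transformed solution is defined. *)
Definition backlund (F : datum ratfun) : Prop :=
  forall (a : params C) (U : set C) (x y : C -> C), solves a U x y ->
  forall W : set C, open W -> W !=set0 -> W `<=` U ->
  forall (a' : params C) (theta xi eta : C -> C),
    (forall t, W t ->
       maps_to F (Datum (x t) (y t) t a)
                 (Datum (xi (theta t)) (eta (theta t)) (theta t) a')) ->
    solves a' (theta @` W) xi eta.

(* Substitution of the datum F for (x,y,t;alpha) in f, computed on a
   representative fraction of f. When the images of x, y, t, alpha_1, alpha_2,
   alpha_3 are algebraically independent it does not depend on the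
   representative, and it is the only C-endomorphism of ratfun with these
   images; see is_automorphism. *)
Definition act (F : datum ratfun) (f : ratfun) : ratfun :=
  mmap cst (coords F) (frac (repr f)).1 / mmap cst (coords F) (frac (repr f)).2.

Definition is_automorphism (F : datum ratfun) : Prop :=
  [/\ zmod_morphism (act F), monoid_morphism (act F), bijective (act F)
    & forall c, act F (cst c) = cst c] /\
  [/\ act F X = cx F, act F Y = cy F & act F T = ct F] /\
  [/\ act F A0 = al0 (cpar F), act F A1 = al1 (cpar F),
      act F A2 = al2 (cpar F) & act F A3 = al3 (cpar F)].

End RationalFunctions.

Variant node := S0 | S1 | S2 | S3.

Definition simple (R : realType) (i : node) : datum (ratfun R) :=
  let x := X R in let y := Y R in let t := T R in
  let a0 := A0 R in let a1 := A1 R in let a2 := A2 R in let a3 := A3 R in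
  match i with
  | S0 => Datum x (y - a0 / (x - 1)) t (Params (- a0) a1 (a2 + a0) a3)
  | S1 => Datum x y t (Params a0 (- a1) (a2 + a1) a3)
  | S2 => Datum (x + a2 / y) y t (Params (a0 + a2) (a1 + a2) (- a2) (a3 + a2))
  | S3 => Datum x (y - 2 * a3 / x + t / x ^+ 2) (- t)
                (Params a0 a1 (a2 + 2 * a3) (- a3))
  end.

Definition diagram (R : realType) : datum (ratfun R) :=
  let x := X R in let y := Y R in let t := T R in
  let a0 := A0 R in let a1 := A1 R in let a2 := A2 R in let a3 := A3 R in
  Datum (x / (x - 1)) (- (x - 1) * ((x - 1) * y + a2)) (- t) (Params a1 a0 a2 a3).

(* Products are compositions of automorphisms of ratfun: [:: i; j] acts as
   f |-> s_i (s_j f). *)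
Definition act_word (R : realType) (w : seq node) : ratfun R -> ratfun R :=
  foldr (fun i phi => act (simple R i) \o phi) id w.

Definition power (n : nat) (w : seq node) : seq node := flatten (nseq n w).

Definition relators : seq (seq node) :=
  [:: power 2 [:: S0]; power 2 [:: S1]; power 2 [:: S2]; power 2 [:: S3];
      power 2 [:: S0; S1]; power 2 [:: S0; S3]; power 2 [:: S1; S3];
      power 3 [:: S0; S2]; power 3 [:: S1; S2]; power 4 [:: S2; S3]].

(* Equality of words in the group presented by the relators, the affine Weyl
   group of type B_3^(1). Words need no formal inverses, since the relators
   make every generator its own inverse. *)
Inductive weyl_eq : seq node -> seq node -> Prop :=
| weyl_refl u : weyl_eq u u
| weyl_sym u v : weyl_eq u v -> weyl_eq v u
| weyl_trans u v w : weyl_eq u v -> weyl_eq v w -> weyl_eq u w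
| weyl_relator (k : 'I_(size relators)) u v :
    weyl_eq (u ++ nth [::] relators k ++ v) (u ++ v).

(* Main.v *)
From HB Require Import structures.
Require Import Defs.
From mathcomp Require Import all_boot all_order all_algebra.
From mathcomp Require Import generic_quotient.
From mathcomp Require Import boolp classical_sets reals topology normedtype derive.
From mathcomp Require Import complex.
From mathcomp Require Import -(notations) mpoly.
From mathcomp Require Import zify ring.

(** Each generator is an involutive rational map, regular away from the zeros of
    one of x, y, x - 1; involutivity makes the corresponding substitution
    injective on polynomials, hence an automorphism of the rational functions,
    and the Coxeter relations become identities between compositions of the
    maps, checked on coordinates. On the linear span of the parameters the
    group acts by its root representation, which is faithful by Tits' argument
    carried out on words: if w and w s_i are both reduced then w sends the
    simple root alpha_i to a nonnegative root. For the Baecklund property, a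
    generator has a value at a point only if the point is regular, so the
    transformed solution is locally the image of the given one, and the chain
    rule leaves a rational identity. *)

Set Implicit Arguments.
Unset Strict Implicit.
Unset Printing Implicit Defensive.

Import Order.TTheory GRing.Theory Num.Theory numFieldNormedType.Exports.

Local Open Scope ring_scope.

(** * The Weyl group of type B_3^(1) and its roots *)

Lemma node_eq_dec (i j : node) : {i = j} + {i <> j}.
Proof. by decide equality. Defined.

HB.instance Definition _ := hasDecEq.Build node (compareP node_eq_dec).

Definition root_lattice : Type := (int * int * int * int)%type.

Definition simple_root (i : node) : root_lattice :=
  match i with
  | S0 => (1, 0, 0, 0)
  | S1 => (0, 1, 0, 0)
  | S2 => (0, 0, 1, 0)
  | S3 => (0, 0, 0, 1)
  end.

(** The Cartan integers are those of the action of the generators on the parameters, which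
    [act_word_root] makes precise. *)
Definition reflect_root (i : node) (v : root_lattice) : root_lattice :=
  let: (a, b, c, d) := v in
  match i with
  | S0 => (c - a, b, c, d)
  | S1 => (a, c - b, c, d)
  | S2 => (a, b, a + b + d - c, d)
  | S3 => (a, b, c, 2 * c - d)
  end.

Definition root_act (w : seq node) (v : root_lattice) : root_lattice := foldr reflect_root v w.

Definition root_ge0 (v : root_lattice) : bool :=
  let: (a, b, c, d) := v in [&& 0 <= a, 0 <= b, 0 <= c & 0 <= d].

Lemma root_act_cat u w v : root_act (u ++ w) v = root_act u (root_act w v).
Proof. exact: foldr_cat. Qed.

Lemma root_actD w a b : root_act w (a + b) = root_act w a + root_act w b.
Proof.
elim: w => [//|i w /= ->].
move: (root_act w a) (root_act w b) => [[[a1 a2] a3] a4] [[[b1 b2] b3] b4].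
have addE x1 x2 x3 x4 y1 y2 y3 y4 :
  (x1, x2, x3, x4) + (y1, y2, y3, y4) = (x1 + y1, x2 + y2, x3 + y3, x4 + y4) :> root_lattice by [].
by case: i; rewrite addE /= addE; congr (_, _, _, _); lia.
Qed.

Lemma root_act0 w : root_act w 0 = 0.
Proof. by apply: (addIr (root_act w 0)); rewrite -root_actD !add0r. Qed.

Lemma root_ge0D a b : root_ge0 a -> root_ge0 b -> root_ge0 (a + b).
Proof.
case: a b => [[[a1 a2] a3] a4] [[[b1 b2] b3] b4] /=.
by move=> /and4P[????] /and4P[????]; apply/and4P; split; apply: addr_ge0.
Qed.

Lemma root_act_ge0 w a b p q : root_ge0 (root_act w a) ->
  root_ge0 (root_act w b) -> root_ge0 (root_act w (a *+ p + b *+ q)).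
Proof.
have wM c k : root_ge0 (root_act w c) -> root_ge0 (root_act w (c *+ k)).
  move=> wc; elim: k => [|k IHk]; first by rewrite mulr0n root_act0.
  by rewrite mulrS root_actD root_ge0D.
by move=> wa wb; rewrite root_actD root_ge0D ?wM.
Qed.

(** * Words modulo the relators *)

Lemma relatorsP (P : seq node -> Prop) :
  (forall r, r \in relators -> P r) ->
  forall k : 'I_(size relators), P (nth [::] relators k).
Proof. by move=> Pr k; apply/Pr/mem_nth. Qed.

Lemma weyl_eq_cat a b u v : weyl_eq u v -> weyl_eq (a ++ u ++ b) (a ++ v ++ b).
Proof.
elim=> {u v} [u|u v _|u v w _ IH1 _ IH2|k u v]; first exact: weyl_refl.
- exact: weyl_sym.
- exact: weyl_trans IH1 IH2.
by have := weyl_relator k (a ++ u) (v ++ b); rewrite !catA.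
Qed.

Lemma weyl_eq_catl a u v : weyl_eq u v -> weyl_eq (a ++ u) (a ++ v).
Proof. by move/(weyl_eq_cat a [::]); rewrite !cats0. Qed.

Lemma weyl_eq_catr b u v : weyl_eq u v -> weyl_eq (u ++ b) (v ++ b).
Proof. exact: (weyl_eq_cat [::] b). Qed.

Lemma weyl_relator_eq r : r \in relators -> weyl_eq r [::].
Proof.
move=> rR; have rS : (index r relators < size relators)%N by rewrite index_mem.
by have := weyl_relator (Ordinal rS) [::] [::]; rewrite /= nth_index ?cats0.
Qed.

Lemma weyl_eq_sqr i : weyl_eq [:: i; i] [::].
Proof. by apply: weyl_relator_eq; case: i. Qed.

Lemma weyl_rev_cat u : weyl_eq (rev u ++ u) [::].
Proof.
elim: u => [|i u IHu]; first exact: weyl_refl.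
rewrite rev_cons -cats1 -catA; apply: weyl_trans IHu.
exact: (weyl_eq_cat (rev u) u (weyl_eq_sqr i)).
Qed.

Lemma weyl_cat_rev u : weyl_eq (u ++ rev u) [::].
Proof. by have := weyl_rev_cat (rev u); rewrite revK. Qed.

Lemma weyl_eq_rev_nil u : weyl_eq u [::] -> weyl_eq (rev u) [::].
Proof.
move=> /(weyl_eq_catl (rev u)); rewrite cats0 => /weyl_sym /weyl_trans; apply.
exact: weyl_rev_cat.
Qed.

(** Every relator has even length, so the sign character is well defined on the presented group. *)
Lemma weyl_eq_odd u v : weyl_eq u v -> odd (size u) = odd (size v).
Proof.
elim=> {u v} [//|//|u v w _ -> _ -> //|k u v].
rewrite !size_cat !oddD; suff -> : odd (size (nth [::] relators k)) = false by [].
apply: (relatorsP (P := fun r => odd (size r) = false)) => r; rewrite !inE.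
by do !case/orP; move/eqP->.
Qed.

Lemma root_act_weyl_eq u v : weyl_eq u v -> root_act u =1 root_act v.
Proof.
elim=> {u v} [//|u v _ IH|u v w _ IH1 _ IH2|k u v] x; first by rewrite IH.
  by rewrite IH1.
rewrite !root_act_cat; congr root_act.
apply: (relatorsP (P := fun r => root_act r =1 id)) => r rR [[[a b] c] d].
by move: rR; rewrite !inE; do !case/orP; move/eqP-> => /=; congr (_, _, _, _); lia.
Qed.

(** * Reduced words *)

Definition reduced (w : seq node) : Prop :=
  forall v, weyl_eq v w -> (size w <= size v)%N.

Lemma exists_reduced w : exists2 v, weyl_eq v w & reduced v.
Proof.
pose P n := `[< exists2 v, weyl_eq v w & size v = n >].
have exP : exists n, P n by exists (size w); apply/asboolP; exists w; [exact: weyl_refl|].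
case: (ex_minnP exP) => n /asboolP[v vw vn] min_n; exists v => // u uv.
rewrite vn; apply: min_n; apply/asboolP; exists u => //.
exact: weyl_trans uv vw.
Qed.

Lemma reduced_weyl_eq u w :
  weyl_eq u w -> size u = size w -> reduced w -> reduced u.
Proof. by move=> uw suw rw v vu; rewrite suw; apply/rw/(weyl_trans vu). Qed.

Lemma reduced_infix a u b : reduced (a ++ u ++ b) -> reduced u.
Proof.
move=> r v vu; have := r _ (weyl_eq_cat a b vu).
by rewrite !size_cat leq_add2l leq_add2r.
Qed.

Lemma reduced_catl u v : reduced (u ++ v) -> reduced u.
Proof. exact: (@reduced_infix [::]). Qed.

Lemma reduced_catr u v : reduced (u ++ v) -> reduced v.
Proof. by move=> r; apply: (@reduced_infix u _ [::]); rewrite cats0. Qed.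

Lemma not_reduced_sqr i : ~ reduced [:: i; i].
Proof. by move=> /(_ _ (weyl_sym (weyl_eq_sqr i))). Qed.

(** * Alternating words and roots of rank two *)

Definition coxeter_order (i j : node) : nat :=
  match i, j with
  | S2, S3 | S3, S2 => 4
  | S2, _ | _, S2 => 3
  | _, _ => 2
  end.

(** Built from the right: a nonempty [alt n i j] ends in [i], the letter that acts first on a
    root. *)
Fixpoint alt (n : nat) (i j : node) : seq node :=
  if n is n'.+1 then rcons (alt n' j i) i else [::].

Lemma size_alt n i j : size (alt n i j) = n.
Proof. by elim: n i j => //= n IHn i j; rewrite size_rcons IHn. Qed.

Lemma alt_coxeter_order i j :
  i != j -> weyl_eq (alt (coxeter_order i j).*2 i j) [::].
Proof.
(* The relators list each pair of generators in one order only; the other order is the reversed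
   word. *)
by case: i j => [] [] // _; first [exact: weyl_relator_eq
  | rewrite -[alt _ _ _]revK; apply: weyl_eq_rev_nil; exact: weyl_relator_eq].
Qed.

Lemma alt_add m n i j : exists u, alt (n + m) i j = u ++ alt m i j.
Proof.
elim: m i j => [|m IHm] i j; first by rewrite addn0; exists (alt n i j); rewrite cats0.
by have [u e] := IHm j i; exists u; rewrite addnS /= e rcons_cat.
Qed.

(** Beyond the Coxeter order m, a suffix of length m + 1 equals in the group the inverse of the
    other m - 1 letters of an alternating word of length 2m, which is trivial; so it can be
    shortened. *)
Lemma reduced_alt n i j : i != j -> reduced (alt n i j) -> (n <= coxeter_order i j)%N.
Proof.
move=> ij; set m := coxeter_order i j; rewrite leqNgt => rn; apply/negP => mn.
have [u e] := alt_add m.+1 (n - m.+1) i j; rewrite subnK // in e.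
have {e rn} ra : reduced (alt m.+1 i j) by apply: (@reduced_catr u); rewrite -e.
have [v e] := alt_add m.+1 m.-1 i j.
have m0 : (0 < m)%N by rewrite /m; case: (i) (j) => [] [].
have := alt_coxeter_order ij; rewrite -/m (_ : m.*2 = m.-1 + m.+1)%N; last by lia.
rewrite e => vm; have sv : size v = m.-1.
  by have := congr1 size e; rewrite size_cat !size_alt; lia.
have : weyl_eq (rev v) (alt m.+1 i j).
  have := weyl_eq_catl (rev v) vm; rewrite cats0 => /weyl_sym /weyl_trans; apply.
  by rewrite catA; exact: (weyl_eq_catr (alt m.+1 i j) (weyl_rev_cat v)).
by move/ra; rewrite size_rev sv size_alt; lia.
Qed.

(** A reduced word has no two equal adjacent letters, so on two letters it must alternate. *)
Lemma reduced_dihedral i j z : all (mem [:: i; j]) z -> reduced (rcons z i) ->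
  rcons z i = alt (size z).+1 i j.
Proof.
elim/last_ind: z i j => [//|z k IHz] i j.
rewrite all_rcons size_rcons => /andP[+ zij] r.
rewrite !inE => /orP[/eqP ki|/eqP kj].
  case: (@not_reduced_sqr i); apply: (@reduced_catr z).
  by move: r; rewrite ki -!cats1 -catA.
rewrite kj (IHz j i) //.
  by apply: sub_all zij => x; rewrite !inE orbC.
by apply: (@reduced_catl _ [:: i]); rewrite cats1 -kj.
Qed.

(** These are positive roots of the rank two systems A1 x A1, A2 and B2; the bound on [n] stops just
    before the sign changes. *)
Lemma alt_simple_root n i j : i != j -> (n < coxeter_order i j)%N ->
  exists p q, root_act (alt n j i) (simple_root i)
              = simple_root i *+ p + simple_root j *+ q.
Proof.
case: i j => [] [] // _; case: n => [|[|[|[|//]]]] // _;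
first [ by exists 0%N, 1%N | by exists 1%N, 0%N | by exists 1%N, 1%N
      | by exists 1%N, 2%N | by exists 2%N, 1%N | by exists 2%N, 2%N ].
Qed.

(* Tits: split w = v z with z in the dihedral subgroup of i and the last letter
   of w, and v as short as possible; then v sends both simple roots of that
   subgroup to nonnegative roots, by induction. *)
Lemma reduced_root_ge0 w i :
  reduced (rcons w i) -> root_ge0 (root_act w (simple_root i)).
Proof.
have [n] := ubnP (size w); elim: n w i => // n IHn w i wn rwi.
case/lastP: w => [|w' t] in wn rwi *; first by case: (i).
rewrite size_rcons ltnS in wn.
have it : i != t.
  apply: contra_notN (@not_reduced_sqr i) => /eqP it.
  by apply: (@reduced_catr w'); move: rwi; rewrite -it -!cats1 -catA.
move ew: (rcons w' t) rwi => w rwi.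
have sw : size w = (size w').+1 by rewrite -ew size_rcons.
pose P k := `[< exists v z : seq node, [/\ size v = k, all (mem [:: i; t]) z,
                    weyl_eq (v ++ z) w & (size v + size z = size w)%N] >].
have exP : exists k, P k.
  exists (size w'); apply/asboolP; exists w', [:: t].
  by split; rewrite ?cats1 ?ew ?addn1 //= ?inE ?eqxx ?orbT //; exact: weyl_refl.
case: (ex_minnP exP) => k /asboolP[v [z [vk zit vzw svz]]] min_k.
(* The factorization with z = t makes [v] strictly shorter than [w], as the induction requires. *)
have kw' : (k <= size w')%N.
  apply: min_k; apply/asboolP; exists w', [:: t].
  by split; rewrite ?cats1 ?ew ?addn1 //= ?inE ?eqxx ?orbT //; exact: weyl_refl.
have rvzi : reduced (v ++ rcons z i).
  apply: (reduced_weyl_eq _ _ rwi); last by rewrite size_cat !size_rcons addnS svz.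
  by rewrite -rcons_cat -!cats1; exact: weyl_eq_catr.
have rv : reduced v := reduced_catl rvzi.
(* If v a could be shortened, parity would make the result exactly one letter shorter than v, and
   moving a into z would contradict the minimality of v. *)
have rva a : a \in [:: i; t] -> reduced (rcons v a).
  move=> ait v' v'va; rewrite leqNgt; apply/negP => slt.
  have v'av : weyl_eq (rcons v' a) v.
    have := weyl_eq_catr [:: a] v'va; rewrite -!cats1 -catA => /weyl_trans; apply.
    by have := weyl_eq_catl v (weyl_eq_sqr a); rewrite cats0.
  have := weyl_eq_odd v'va; have := rv _ v'av; rewrite !size_rcons => le1 podd.
  rewrite size_rcons in slt.
  have sv' : (size v').+1 = size v by lia.
  suff : (k <= size v')%N by lia.
  apply: min_k; apply/asboolP; exists v', (a :: z); split=> //=.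
  - by rewrite ait.
  - by rewrite -cat_rcons; apply: weyl_trans vzw; exact: weyl_eq_catr.
  - by lia.
have rzi : reduced (rcons z i) := reduced_catr rvzi.
have ezi := reduced_dihedral zit rzi.
(* The word [rcons z i] has one letter more than [z], whence the strict inequality. *)
have szm : (size z < coxeter_order i t)%N by apply: reduced_alt; rewrite // -ezi.
have ez : z = alt (size z) t i.
  by have /rcons_inj[] : rcons z i = rcons (alt (size z) t i) i by rewrite ezi.
rewrite -(root_act_weyl_eq vzw) root_act_cat ez.
have [p [q ->]] := alt_simple_root it szm.
have vn : (size v < n)%N by lia.
by apply: root_act_ge0; apply: IHn => //; apply: rva; rewrite !inE eqxx ?orbT.
Qed.

(** If a reduced representative were u i, then u would send alpha_i to its negative, against
    [reduced_root_ge0]. *)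
Lemma weyl_faithful w :
  (forall i, root_act w (simple_root i) = simple_root i) -> weyl_eq w [::].
Proof.
move=> w1; have [v vw rv] := exists_reduced w; apply: weyl_trans (weyl_sym vw) _.
case/lastP: v => [|u i] in vw rv *; first exact: weyl_refl.
have := w1 i; rewrite -(root_act_weyl_eq vw) -cats1 root_act_cat.
have -> : root_act [:: i] (simple_root i) = - simple_root i by case: (i).
have := reduced_root_ge0 rv.
have uN := root_actD u (simple_root i) (- simple_root i).
move: uN; rewrite subrr root_act0.
by move=> uN u_ge0 ui; move: uN u_ge0; rewrite ui => /esym/eqP;
   rewrite addr_eq0 => /eqP ->; case: (i).
Qed.

(** * The generators as rational maps *)

Section Moves.
Variable K : fieldType.
Implicit Types (g : option node) (v : datum K).

(* [None] stands for the diagram automorphism. *)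
Definition move g v : datum K :=
  let x := cx v in let y := cy v in let t := ct v in
  let a0 := al0 (cpar v) in let a1 := al1 (cpar v) in
  let a2 := al2 (cpar v) in let a3 := al3 (cpar v) in
  match g with
  | Some S0 => Datum x (y - a0 / (x - 1)) t (Params (- a0) a1 (a2 + a0) a3)
  | Some S1 => Datum x y t (Params a0 (- a1) (a2 + a1) a3)
  | Some S2 => Datum (x + a2 / y) y t (Params (a0 + a2) (a1 + a2) (- a2) (a3 + a2))
  | Some S3 => Datum x (y - 2 * a3 / x + t / x ^+ 2) (- t)
                 (Params a0 a1 (a2 + 2 * a3) (- a3))
  | None => Datum (x / (x - 1)) (- (x - 1) * ((x - 1) * y + a2)) (- t)
              (Params a1 a0 a2 a3)
  end.

Definition regular g v : bool :=
  match g with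
  | Some S0 | None => cx v - 1 != 0
  | Some S1 => true
  | Some S2 => cy v != 0
  | Some S3 => cx v != 0
  end.

Definition moves v (w : seq (option node)) : datum K := foldl (fun u g => move g u) v w.

Lemma moveK g v : regular g v -> move g (move g v) = v.
Proof.
case: v => x y t [a0 a1 a2 a3]; case: g => [[]|] /= reg; rewrite /move /=;
  congr (Datum _ _ _ (Params _ _ _ _)); (ring || field); rewrite ?reg //=.
by rewrite mulN1r opprB addrC subrK oner_neq0.
Qed.

Lemma move_balanced g v : balanced (cpar v) -> balanced (cpar (move g v)).
Proof.
case: v => x y t [a0 a1 a2 a3]; rewrite /balanced /= => e; apply: etrans e.
by case: g => [[]|] /=; ring.
Qed.

Lemma regular_move g v : regular g v -> regular g (move g v).
Proof.
case: v => x y t [a0 a1 a2 a3]; case: g => [[]|] //= x1.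
(* Only the diagram map changes its own denominator: x/(x-1) - 1 = 1/(x-1). *)
by rewrite (_ : _ - 1 = (x - 1)^-1) ?invr_eq0 //; field.
Qed.

(** * Commutation, braid and diagram relations of the maps *)

Ltac datum_eq :=
  rewrite /moves /move /=; congr (Datum _ _ _ (Params _ _ _ _)); try ring.

Lemma moves_comm01 v : moves v [:: Some S0; Some S1] = moves v [:: Some S1; Some S0].
Proof. by case: v => x y t [a0 a1 a2 a3]; datum_eq. Qed.

Lemma moves_comm03 v : moves v [:: Some S0; Some S3] = moves v [:: Some S3; Some S0].
Proof. by case: v => x y t [a0 a1 a2 a3]; datum_eq. Qed.

Lemma moves_comm13 v : moves v [:: Some S1; Some S3] = moves v [:: Some S3; Some S1].
Proof. by case: v => x y t [a0 a1 a2 a3]; datum_eq. Qed.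

Lemma moves_braid12 v : cy v != 0 ->
  moves v [:: Some S1; Some S2; Some S1] = moves v [:: Some S2; Some S1; Some S2].
Proof. by case: v => x y t [a0 a1 a2 a3] /= y0; datum_eq; field. Qed.

(** After s_0, y is ((x-1)y - a0)/(x-1); after s_2, x - 1 is ((x-1)y + a2)/y. The last two
    hypotheses keep these numerators nonzero. *)
Lemma moves_braid02 v : cx v - 1 != 0 -> cy v != 0 ->
  (cx v - 1) * cy v - al0 (cpar v) != 0 -> (cx v - 1) * cy v + al2 (cpar v) != 0 ->
  moves v [:: Some S0; Some S2; Some S0] = moves v [:: Some S2; Some S0; Some S2].
Proof.
case: v => x y t [a0 a1 a2 a3] /= x1 y0 h1 h2; datum_eq; field.
all: rewrite x1 y0 ?andbT /=; apply/and3P; split=> //.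
all: try by rewrite (_ : _ + -1 * y = (x - 1) * y + a2) //; ring.
all: try by rewrite (_ : _ - a0 = (x - 1) * y - a0) //; ring.
  by rewrite (_ : _ - _ * y = y * ((x - 1) * y - a0)) ?mulf_neq0 //; ring.
by rewrite (_ : _ + -1 * _ = (x - 1) * ((x - 1) * y + a2)) ?mulf_neq0 //; ring.
Qed.

(** Up to nonzero factors, the last four quantities are numerators of intermediate coordinates: x
    after s_2, x after s_3 then s_2, y after s_3, y after s_2 then s_3. *)
Lemma moves_braid23 v (x := cx v) (y := cy v) (t := ct v)
    (a2 := al2 (cpar v)) (a3 := al3 (cpar v)) (p := x * y + a2) :
  x != 0 -> y != 0 -> p != 0 -> x * p + t != 0 ->
  x ^+ 2 * y - 2 * a3 * x + t != 0 -> p ^+ 2 - 2 * (a2 + a3) * p + t * y != 0 ->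
  moves v [:: Some S2; Some S3; Some S2; Some S3]
  = moves v [:: Some S3; Some S2; Some S3; Some S2].
Proof.
rewrite {}/p {}/x {}/y {}/t {}/a2 {}/a3.
case: v => x y t [a0 a1 a2 a3] /= x0 y0 p0 s0 r0 q0.
have er : (y * x - 2 * a3) * x + t = x ^+ 2 * y - 2 * a3 * x + t by ring.
have es : x * (x ^+ 2 * y - 2 * a3 * x + t) + (a2 + 2 * a3) * (x * x)
  = x * (x * (x * y + a2) + t) by ring.
have q1 : (y * (x * y + a2) - 2 * (a3 + a2) * y) * (x * y + a2) + t * y ^+ 2 != 0.
  rewrite (_ : _ + _ = y * ((x * y + a2) ^+ 2 - 2 * (a2 + a3) * (x * y + a2) + t * y));
    last by ring.
  by rewrite mulf_neq0.
datum_eq; field; rewrite x0 y0 p0 ?er ?es r0 q1 ?mulf_neq0 ?andbT //=.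
  rewrite [X in X != 0](_ : _ = (x ^+ 2 * y - 2 * a3 * x + t) * x ^+ 4
    * ((x * y + a2) ^+ 2 - 2 * (a2 + a3) * (x * y + a2) + t * y)); last by ring.
  by rewrite !mulf_neq0 ?expf_neq0.
rewrite [X in X != 0](_ : _ = y ^+ 2 * (x * y + a2) * (x * (x * y + a2) + t)); last by ring.
by rewrite !mulf_neq0 ?expf_neq0.
Qed.

Lemma moves_diagramS0 v : cx v - 1 != 0 ->
  moves v [:: None; Some S0] = moves v [:: Some S1; None].
Proof.
case: v => x y t [a0 a1 a2 a3] /= x1; datum_eq; field.
by rewrite x1 mulN1r opprB addrC subrK oner_neq0.
Qed.

Lemma moves_diagramS2 v : cx v - 1 != 0 -> cy v != 0 ->
  (cx v - 1) * cy v + al2 (cpar v) != 0 ->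
  moves v [:: None; Some S2] = moves v [:: Some S2; None].
Proof.
case: v => x y t [a0 a1 a2 a3] /= x1 y0 h; datum_eq; field.
all: rewrite // oppr_eq0 x1 y0 /= andbT.
by rewrite [X in X != 0](_ : _ = (x - 1) * y + a2) //; ring.
Qed.

Lemma moves_diagramS3 v : cx v != 0 -> cx v - 1 != 0 ->
  moves v [:: None; Some S3] = moves v [:: Some S3; None].
Proof.
case: v => x y t [a0 a1 a2 a3] /= x0 x1; datum_eq; field.
by rewrite x0 x1.
Qed.

End Moves.

Definition map_datum (K L : Type) (f : K -> L) (v : datum K) : datum L :=
  let: Datum x y t (Params a0 a1 a2 a3) := v in
  Datum (f x) (f y) (f t) (Params (f a0) (f a1) (f a2) (f a3)).

Lemma map_datum_move (K L : fieldType) (f : {rmorphism K -> L}) g v :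
  map_datum f (move g v) = move g (map_datum f v).
Proof.
case: v => x y t [a0 a1 a2 a3]; case: g => [[]|]; rewrite /move /=;
congr (Datum _ _ _ (Params _ _ _ _));
by rewrite ?(rmorphN, rmorphD, rmorphM, fmorphV, rmorph1, rmorphXn, rmorph_nat).
Qed.

(** * Substitution in rational functions *)

Lemma frac_repr (A : idomainType) (f : {fraction A}) :
  f = tofrac (frac (repr f)).1 / tofrac (frac (repr f)).2.
Proof.
have d0 := denom_ratioP (repr f).
apply: (canRL (mulfK _)); first by rewrite tofrac_eq0.
move: d0; rewrite -{2}[f]reprK; move: (repr f) => r d0.
rewrite !piE; apply/eqmodP; rewrite /= FracField.equivfE /FracField.mulf.
by rewrite !numden_Ratio ?mulr1 ?oner_eq0 // mulrC.
Qed.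

Lemma fractionP (A : idomainType) (f : {fraction A}) :
  exists p q : A, q != 0 /\ f = tofrac p / tofrac q.
Proof.
by exists (frac (repr f)).1, (frac (repr f)).2; split;
  [exact: denom_ratioP|exact: frac_repr].
Qed.

(** * Values of fractions under a ring morphism *)

Section FracAt.
Variables (A : idomainType) (K : fieldType) (h : {rmorphism A -> K}).

(* The partial extension of [h] to fractions whose denominator it does not kill;
   [value_at] is the case of an evaluation at a point. *)
Definition frac_at (f : {fraction A}) (c : K) : Prop :=
  exists p q : A, [/\ f = tofrac p / tofrac q, h q != 0 & c = h p / h q].

Lemma rmorph_neq0 q : h q != 0 -> q != 0.
Proof. by apply: contra_neq => ->; rewrite rmorph0. Qed.

Lemma frac_at_tofrac p : frac_at (tofrac p) (h p).
Proof. by exists p, 1; rewrite !rmorph1 !divr1 oner_eq0. Qed.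

(** Cross-multiplying two representations gives an identity in [A], which [h] carries over. *)
Lemma frac_at_unique f c d : frac_at f c -> frac_at f d -> c = d.
Proof.
move=> [p [q [-> hq ->]]] [p' [q' [e hq' ->]]].
have [q0 q0'] := (rmorph_neq0 hq, rmorph_neq0 hq').
apply/eqP; rewrite eqr_div // -!rmorphM; apply/eqP; congr (h _); apply/eqP.
by move/eqP: e; rewrite eqr_div ?tofrac_eq0 // -!rmorphM tofrac_eq.
Qed.

Lemma frac_atD f g c d : frac_at f c -> frac_at g d -> frac_at (f + g) (c + d).
Proof.
move=> [p [q [-> hq ->]]] [p' [q' [-> hq' ->]]].
have [q0 q0'] := (rmorph_neq0 hq, rmorph_neq0 hq').
exists (p * q' + p' * q), (q * q'); split.
- by rewrite addf_div ?tofrac_eq0 // rmorphD !rmorphM.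
- by rewrite rmorphM mulf_neq0.
- by rewrite addf_div // rmorphD !rmorphM.
Qed.

Lemma frac_atM f g c d : frac_at f c -> frac_at g d -> frac_at (f * g) (c * d).
Proof.
move=> [p [q [-> hq ->]]] [p' [q' [-> hq' ->]]].
by exists (p * p'), (q * q'); rewrite mulf_div mulf_div !rmorphM mulf_neq0.
Qed.

Lemma frac_atN f c : frac_at f c -> frac_at (- f) (- c).
Proof.
move=> [p [q [-> hq ->]]]; exists (- p), q.
by rewrite !rmorphN !mulNr.
Qed.

Lemma frac_atB f g c d : frac_at f c -> frac_at g d -> frac_at (f - g) (c - d).
Proof. by move=> fc gd; apply: frac_atD => //; apply: frac_atN. Qed.

Lemma frac_atV f c : c != 0 -> frac_at f c -> frac_at f^-1 c^-1.
Proof.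
move=> c0 [p [q [-> hq e]]]; exists q, p; rewrite !invf_div; split=> //.
  by apply: contra_neq c0 => hp; rewrite e hp mul0r.
by rewrite e invf_div.
Qed.

Lemma frac_at_nat n : frac_at n%:R n%:R.
Proof. by have := frac_at_tofrac n%:R; rewrite !rmorph_nat. Qed.

Lemma frac_atX f c n : frac_at f c -> frac_at (f ^+ n) (c ^+ n).
Proof.
move=> fc; elim: n => [|n IHn]; first exact: (frac_at_nat 1).
by rewrite !exprS; apply: frac_atM.
Qed.

End FracAt.

Section Actions.
Variable R : realType.
Notation C := (cplx R).

HB.instance Definition _ := GRing.RMorphism.copy (@cst R)
  (@FracField.tofrac (mpoly 6 C) \o @mpolyC 6 C).

Definition pullback (F : datum (ratfun R)) : {rmorphism mpoly 6 C -> ratfun R} :=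
  mmap (@cst R) (coords F).

Lemma actE F f : act F f = pullback F (frac (repr f)).1 / pullback F (frac (repr f)).2.
Proof. by []. Qed.
End Actions.

Section DatumAt.
Variables (A : idomainType) (K : fieldType) (h : {rmorphism A -> K}).

Definition datum_at (f : datum {fraction A}) (v : datum K) : Prop :=
  [/\ frac_at h (cx f) (cx v), frac_at h (cy f) (cy v) & frac_at h (ct f) (ct v)] /\
  [/\ frac_at h (al0 (cpar f)) (al0 (cpar v)), frac_at h (al1 (cpar f)) (al1 (cpar v)),
      frac_at h (al2 (cpar f)) (al2 (cpar v)) & frac_at h (al3 (cpar f)) (al3 (cpar v))].

Lemma datum_at_move g f v :
  datum_at f v -> regular g v -> datum_at (move g f) (move g v).
Proof.
case: f v => x y t [a0 a1 a2 a3] [x' y' t' [a0' a1' a2' a3']].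
move=> [[/= fx fy ft] [f0 f1 f2 f3]].
have one : frac_at h 1 1 := frac_at_nat h 1.
have two : frac_at h 2 2 := frac_at_nat h 2.
have x1 := frac_atB fx one.
case: g => [[]|] //= reg; split; split=> //=;
  do ?[assumption | apply: frac_atD | apply: frac_atN | apply: frac_atM
      | apply: frac_atV | apply: frac_atX]; rewrite ?expf_neq0 //.
Qed.

Lemma datum_at_unique f v w : datum_at f v -> datum_at f w -> v = w.
Proof.
case: v w => x y t [a0 a1 a2 a3] [x' y' t' [a0' a1' a2' a3']] [[/= fx fy ft] [f0 f1 f2 f3]].
case=> [[/= gx gy gt] [g0 g1 g2 g3]].
by congr (Datum _ _ _ (Params _ _ _ _)); apply: frac_at_unique; eassumption.
Qed.

End DatumAt.

(** * The generators as automorphisms *)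

Section Substitution.
Variable R : realType.
Notation C := (cplx R).

Definition base : datum (ratfun R) :=
  Datum (X R) (Y R) (T R) (Params (A0 R) (A1 R) (A2 R) (A3 R)).

Definition gen (g : option node) : datum (ratfun R) :=
  if g is Some i then simple R i else diagram R.

Lemma genE g : gen g = move g base. Proof. by case: g => [[]|]. Qed.

(** [A0] is a fixed affine form in the other parameters; balance of [v] makes its value agree with
    [al0]. *)
Lemma datum_at_base (K : fieldType) (h : {rmorphism mpoly 6 C -> K}) (v : datum K) :
  balanced (cpar v) -> (forall i, h (mpolyX C (mnm1 i)) = coords v i) -> datum_at h base v.
Proof.
move=> bal hX.
have var_at k : (k < 6)%N -> frac_at h (var R k)
    (nth 0 [:: cx v; cy v; ct v; al1 (cpar v); al2 (cpar v); al3 (cpar v)] k).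
  by move=> k6; have := frac_at_tofrac h (mpolyX C (mnm1 (inord k)));
     rewrite hX /coords inordK.
split; split; [exact: (var_at 0%N isT)|exact: (var_at 1%N isT)|exact: (var_at 2%N isT)
  | |exact: (var_at 3%N isT)|exact: (var_at 4%N isT)|exact: (var_at 5%N isT)].
have -> : al0 (cpar v) = 1 - al1 (cpar v) - 2 * al2 (cpar v) - 2 * al3 (cpar v).
  by rewrite -[X in X - _ - _ - _]bal; ring.
apply: frac_atB; first apply: frac_atB; first apply: frac_atB.
- exact: (frac_at_nat h 1).
- exact: (var_at 3%N isT).
- by apply: frac_atM; [exact: (frac_at_nat h 2)|exact: (var_at 4%N isT)].
- by apply: frac_atM; [exact: (frac_at_nat h 2)|exact: (var_at 5%N isT)].
Qed.

Lemma base_balanced : balanced (cpar base).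
Proof. by rewrite /balanced /= /A0; ring. Qed.

Lemma gen_balanced g : balanced (cpar (gen g)).
Proof. by rewrite genE; apply/move_balanced/base_balanced. Qed.

Lemma pullbackC F (c : C) : pullback F (mpolyC 6 c) = @cst R c.
Proof. exact: mmapC. Qed.

Lemma pullbackX F i : pullback F (mpolyX C (mnm1 i)) = coords F i.
Proof. by rewrite /pullback /= mmapX mmap1U. Qed.

Lemma tofracX i : tofrac (mpolyX C (mnm1 i)) = coords base i.
Proof.
have -> : mpolyX C (mnm1 i) = mpolyX C (mnm1 (inord i)) by rewrite inord_val.
by case: i => [[|[|[|[|[|[|//]]]]]] Hi]; rewrite /coords /=.
Qed.

Lemma mpoly6_ind (P : mpoly 6 C -> Prop) :
  (forall c, P (mpolyC 6 c)) -> (forall i, P (mpolyX C (mnm1 i))) ->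
  (forall p q, P p -> P q -> P (p + q)) -> (forall p q, P p -> P q -> P (p * q)) ->
  forall p, P p.
Proof.
move=> PC PX PD PM; elim/mpolyind => [|c m p _ _ Pp]; first by have := PC 0; rewrite mpolyC0.
apply: PD Pp; rewrite -mul_mpolyC; apply: (PM _ _ (PC c)).
have P1 : P 1 by have := PC 1; rewrite mpolyC1.
rewrite mpolyXE_id; apply: big_ind => // i _.
by elim: (m i) => [|k IHk]; rewrite ?expr0 // exprS; apply: PM.
Qed.

(* A point at which no denominator met below vanishes. *)
Definition sample : datum C := Datum 2 2 1 (Params 1 0 0 0).

Lemma datum_at_meval (v : datum C) : balanced (cpar v) -> datum_at (meval (coords v)) base v.
Proof. by move=> bal; apply: datum_at_base => // i; exact: mevalXU. Qed.

(** A positive integer value at one point certifies that f is not zero. The numeral passed below is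
    one less than that value. *)
Lemma sample_neq0 f c n : frac_at (meval (coords sample)) f c -> c = n.+1%:R -> f != 0.
Proof.
move=> fn c_n; apply/eqP => f0; have := frac_at_nat (meval (coords sample)) 0.
rewrite mulr0n -f0 => /(frac_at_unique fn)/eqP.
by rewrite c_n mulr0n pnatr_eq0.
Qed.

Lemma sample_at : datum_at (meval (coords sample)) base sample.
Proof. by apply: datum_at_meval; rewrite /balanced /=; ring. Qed.

Ltac at_sample := have [[/= fx fy ft] [f0 f1 f2 f3]] := sample_at;
  have one := frac_at_nat (meval (coords sample)) 1;
  have two := frac_at_nat (meval (coords sample)) 2;
  do ?[eassumption | apply: frac_atD | apply: frac_atN | apply: frac_atM | apply: frac_atX].

Lemma X_neq0 : X R != 0.
Proof. by apply: (@sample_neq0 _ _ 1); [at_sample|rewrite /=; ring]. Qed.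

Lemma Y_neq0 : Y R != 0.
Proof. by apply: (@sample_neq0 _ _ 1); [at_sample|rewrite /=; ring]. Qed.

Lemma X1_neq0 : X R - 1 != 0.
Proof. by apply: (@sample_neq0 _ _ 0); [at_sample|rewrite /=; ring]. Qed.

Lemma X1Y_A0_neq0 : (X R - 1) * Y R - A0 R != 0.
Proof. by apply: (@sample_neq0 _ _ 0); [at_sample|rewrite /=; ring]. Qed.

Lemma X1Y_A2_neq0 : (X R - 1) * Y R + A2 R != 0.
Proof. by apply: (@sample_neq0 _ _ 1); [at_sample|rewrite /=; ring]. Qed.

Lemma XY_A2_neq0 : X R * Y R + A2 R != 0.
Proof. by apply: (@sample_neq0 _ _ 3); [at_sample|rewrite /=; ring]. Qed.

Lemma moves_base_braid23 :
  moves base [:: Some S2; Some S3; Some S2; Some S3]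
  = moves base [:: Some S3; Some S2; Some S3; Some S2].
Proof.
apply: moves_braid23; [exact: X_neq0|exact: Y_neq0|exact: XY_A2_neq0| | | ].
- by apply: (@sample_neq0 _ _ 8); [at_sample|rewrite /=; ring].
- by apply: (@sample_neq0 _ _ 8); [at_sample|rewrite /=; ring].
- by apply: (@sample_neq0 _ _ 17); [at_sample|rewrite /=; ring].
Qed.

Lemma regular_base g : regular g base.
Proof.
case: g => [[]|]; [exact: X1_neq0|by []|exact: Y_neq0|exact: X_neq0|exact: X1_neq0].
Qed.

(* The extension of the substitution to fractions is not yet known to be total,
   so its involutivity is expressed by [frac_at]. *)
Lemma pullback_gen_involutive g p :
  frac_at (pullback (gen g)) (pullback (gen g) p) (tofrac p).
Proof.
have regg : regular g (gen g) by rewrite genE; apply/regular_move/regular_base.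
have base_gen : datum_at (pullback (gen g)) base (gen g).
  by apply: datum_at_base; [exact: gen_balanced|exact: pullbackX].
(* Moving a value of [base] gives a value of [gen g]; here it is [base] again, the map being an
   involution. *)
have gen_base : datum_at (pullback (gen g)) (gen g) base.
  have e : move g (gen g) = base by rewrite genE (moveK (regular_base g)).
  by have := datum_at_move base_gen regg; rewrite e -genE.
elim/mpoly6_ind: p => [c|i|p q IHp IHq|p q IHp IHq].
- rewrite pullbackC; have := frac_at_tofrac (pullback (gen g)) (mpolyC 6 c).
  by rewrite pullbackC.
- rewrite pullbackX tofracX.
  have [[gx gy gt] [_ g1 g2 g3]] := gen_base.
  by case: i => [[|[|[|[|[|[|//]]]]]] Hi].
- by rewrite !rmorphD; apply: frac_atD.
- by rewrite !rmorphM; apply: frac_atM.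
Qed.

(** An involution is injective: were the image of p zero, the second application would have both 0
    and p as its value. *)
Lemma pullback_gen_eq0 g p : (pullback (gen g) p == 0) = (p == 0).
Proof.
apply/eqP/eqP => [p0|->]; last by rewrite rmorph0.
have := pullback_gen_involutive g p; rewrite p0.
move/(frac_at_unique (frac_at_nat _ 0)) => /eqP.
by rewrite mulr0n eq_sym tofrac_eq0 => /eqP.
Qed.

(** By injectivity no nonzero denominator is killed, so the result does not depend on the
    representative that [act] picks. *)
Lemma act_gen_frac g p q : q != 0 ->
  act (gen g) (tofrac p / tofrac q) = pullback (gen g) p / pullback (gen g) q.
Proof.
set f := tofrac p / tofrac q => q0; rewrite actE.
apply: (@frac_at_unique _ _ (pullback (gen g)) f).
  exists (frac (repr f)).1, (frac (repr f)).2; split=> //; first exact: frac_repr.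
  by rewrite pullback_gen_eq0 denom_ratioP.
by exists p, q; rewrite pullback_gen_eq0.
Qed.

Lemma act_gen_zmod g : zmod_morphism (act (gen g)).
Proof.
move=> f f'; have [p [q [q0 ->]]] := fractionP f; have [p' [q' [q0' ->]]] := fractionP f'.
have -> : tofrac p / tofrac q - tofrac p' / tofrac q'
    = tofrac (p * q' - p' * q) / tofrac (q * q').
  by rewrite -mulNr addf_div ?tofrac_eq0 // rmorphB !rmorphM mulNr.
rewrite !act_gen_frac ?mulf_neq0 //.
by rewrite -[in RHS]mulNr [RHS]addf_div ?pullback_gen_eq0 // rmorphB !rmorphM mulNr.
Qed.

Lemma act_gen_monoid g : monoid_morphism (act (gen g)).
Proof.
split=> [|f f'].
  have := act_gen_frac g 1 (oner_neq0 (mpoly 6 C)).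
  by rewrite !rmorph1 !divr1.
have [p [q [q0 ->]]] := fractionP f; have [p' [q' [q0' ->]]] := fractionP f'.
have -> : tofrac p / tofrac q * (tofrac p' / tofrac q')
    = tofrac (p * p') / tofrac (q * q').
  by rewrite mulf_div !rmorphM.
by rewrite !act_gen_frac ?mulf_neq0 // mulf_div !rmorphM.
Qed.

HB.instance Definition _ g := GRing.isZmodMorphism.Build _ _ (act (gen g)) (act_gen_zmod g).
HB.instance Definition _ g := GRing.isMonoidMorphism.Build _ _ (act (gen g)) (act_gen_monoid g).

Lemma act_gen_tofrac g p : act (gen g) (tofrac p) = pullback (gen g) p.
Proof.
have := act_gen_frac g p (oner_neq0 (mpoly 6 C)).
by rewrite !rmorph1 !divr1.
Qed.

Lemma act_gen_cst g c : act (gen g) (cst c) = cst c.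
Proof. by rewrite /cst act_gen_tofrac pullbackC. Qed.

Lemma map_act_base g : map_datum (act (gen g)) base = gen g.
Proof.
apply: (@datum_at_unique _ _ (pullback (gen g)) base); last first.
  by apply: datum_at_base; [exact: gen_balanced|exact: pullbackX].
have frac_at_act f : frac_at (pullback (gen g)) f (act (gen g) f).
  have [p [q [q0 ->]]] := fractionP f; rewrite act_gen_frac //.
  by exists p, q; rewrite pullback_gen_eq0.
by split; split; apply: frac_at_act.
Qed.

Lemma ratfun_rmorph_eq (f g : {rmorphism ratfun R -> ratfun R}) :
  (forall c, f (cst c) = cst c) -> (forall c, g (cst c) = cst c) ->
  map_datum f base = map_datum g base -> f =1 g.
Proof.
move=> fc gc fg; have fgp p : f (tofrac p) = g (tofrac p).
  elim/mpoly6_ind: p => [c|i|p q IHp IHq|p q IHp IHq].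
  - by rewrite -/(cst c) fc gc.
  - rewrite tofracX; case: fg => e0 e1 e2 _ e3 e4 e5.
    by case: i => [[|[|[|[|[|[|//]]]]]] Hi].
  - by rewrite !rmorphD IHp IHq.
  - by rewrite !rmorphM IHp IHq.
by move=> u; have [p [q [_ ->]]] := fractionP u; rewrite !fmorph_div !fgp.
Qed.

Definition act_gens (w : seq (option node)) : ratfun R -> ratfun R :=
  foldr (fun g phi => act (gen g) \o phi) id w.

Lemma act_gens_zmod w : zmod_morphism (act_gens w).
Proof. by elim: w => [//|g w IHw] f f' /=; rewrite IHw rmorphB. Qed.

Lemma act_gens_monoid w : monoid_morphism (act_gens w).
Proof.
by elim: w => [//|g w [IH1 IHM]]; split=> [|f f'] /=; rewrite ?IH1 ?rmorph1 // IHM rmorphM.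
Qed.

HB.instance Definition _ w := GRing.isZmodMorphism.Build _ _ (act_gens w) (act_gens_zmod w).
HB.instance Definition _ w := GRing.isMonoidMorphism.Build _ _ (act_gens w) (act_gens_monoid w).

Lemma act_gens_cat u w f : act_gens (u ++ w) f = act_gens u (act_gens w f).
Proof. by elim: u => //= g u ->. Qed.

Lemma act_gens_cst w c : act_gens w (cst c) = cst c.
Proof. by elim: w => //= g w ->; rewrite act_gen_cst. Qed.

(** The last letter of a word acts first on [base], turning it into [move g base]; the remaining
    automorphism passes through [move]. Hence the leftmost letter moves the point first. *)
Lemma map_act_gens_base w : map_datum (act_gens w) base = moves base w.
Proof.
elim/last_ind: w => [//|w g IHw].
rewrite /moves -cats1 foldl_cat /= -/(moves base w) -IHw -map_datum_move -genE.
rewrite -(map_act_base g) /map_datum /=.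
by rewrite !act_gens_cat.
Qed.

Lemma act_gens_eq u w : moves base u = moves base w -> act_gens u =1 act_gens w.
Proof.
move=> uw; apply: ratfun_rmorph_eq; try exact: act_gens_cst.
by rewrite !map_act_gens_base.
Qed.

Lemma act_genK g : act (gen g) \o act (gen g) =1 id.
Proof.
apply: (@act_gens_eq [:: g; g] [::]).
by rewrite /moves /= moveK ?regular_base.
Qed.

Lemma act_gen_automorphism g : is_automorphism (gen g).
Proof.
split; [split|].
- exact: act_gen_zmod.
- exact: act_gen_monoid.
- by exists (act (gen g)); apply: act_genK.
- exact: act_gen_cst.
have := map_act_base g; rewrite /map_datum /=.
by case: (gen g) => x y t [a0 a1 a2 a3] [] *.
Qed.

Lemma act_gensK w : act_gens (rev w ++ w) =1 id.
Proof.
elim: w => [//|g w IHw] f; rewrite rev_cons -cats1 -catA act_gens_cat /=.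
by rewrite [act (gen g) _]act_genK /= -act_gens_cat IHw.
Qed.

(** The inverse of a word in involutions is its reversal, so cutting a relator in two turns it into
    a commutation or braid relation. *)
Lemma act_gens_relator u w :
  moves base u = moves base (rev w) -> act_gens (u ++ w) =1 id.
Proof. by move=> uw f; rewrite act_gens_cat (act_gens_eq uw) -act_gens_cat act_gensK. Qed.

Lemma act_word_gens w : act_word w =1 act_gens (map some w).
Proof. by elim: w => [//|i w IHw] f; rewrite /= -IHw. Qed.

End Substitution.

(** * The relations and their completeness *)

Section Words.
Variable R : realType.
Notation C := (cplx R).
Notation base := (base R).

Lemma act_word_relator r : r \in relators -> @act_word R r =1 id.
Proof.
suff /allP rel : all (fun r => `[< @act_word R r =1 id >]) relators by move/rel/asboolP.
have actP u w : moves base (map some u) = moves base (rev (map some w)) ->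
    `[< @act_word R (u ++ w) =1 id >].
  by move=> uw; apply/asboolP => f; rewrite act_word_gens map_cat act_gens_relator.
rewrite /relators /=; apply/and5P; split.
- exact: (actP [:: S0] [:: S0] erefl).
- exact: (actP [:: S1] [:: S1] erefl).
- exact: (actP [:: S2] [:: S2] erefl).
- exact: (actP [:: S3] [:: S3] erefl).
apply/and5P; split.
- exact: (actP [:: S0; S1] [:: S0; S1] (moves_comm01 base)).
- exact: (actP [:: S0; S3] [:: S0; S3] (moves_comm03 base)).
- exact: (actP [:: S1; S3] [:: S1; S3] (moves_comm13 base)).
- apply: (actP [:: S0; S2; S0] [:: S2; S0; S2]) => //.
  by apply: moves_braid02; [exact: X1_neq0|exact: Y_neq0|exact: X1Y_A0_neq0|exact: X1Y_A2_neq0].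
apply/and3P; split; last by [].
  apply: (actP [:: S1; S2; S1] [:: S2; S1; S2]) => //.
  exact/moves_braid12/Y_neq0.
exact: (actP [:: S2; S3; S2; S3] [:: S2; S3; S2; S3]
  (moves_base_braid23 R)).
Qed.

Lemma act_word_cat u w f : @act_word R (u ++ w) f = act_word u (act_word w f).
Proof. by elim: u => [//|i u IHu]; exact: (congr1 (act (simple R i)) IHu). Qed.

Lemma act_word_weyl_eq u w : weyl_eq u w -> @act_word R u =1 @act_word R w.
Proof.
elim=> {u w} [//|u v _ IH|u v w _ IH1 _ IH2|k u v] f; first by rewrite IH.
  by rewrite IH1.
rewrite !act_word_cat; congr (act_word u _).
by apply: (relatorsP (P := fun r => @act_word R r =1 id)) => r; exact: act_word_relator.
Qed.

Definition root_fun (v : root_lattice) : ratfun R :=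
  let: (a, b, c, d) := v in
  a%:~R * A0 R + b%:~R * A1 R + c%:~R * A2 R + d%:~R * A3 R.

Lemma act_word_root w v : act_word w (root_fun v) = root_fun (root_act w v).
Proof.
elim: w => [//|i w IHw]; rewrite /= IHw.
move: (root_act w v) => [[[a b] c] d].
have [_ [_ [e0 e1 e2 e3]]] : is_automorphism (simple R i) := act_gen_automorphism R (Some i).
rewrite -[simple R i]/(gen R (Some i)) /root_fun !rmorphD !rmorphM !rmorph_int /= e0 e1 e2 e3.
by case: i {e0 e1 e2 e3} => /=; ring.
Qed.

(** The linear relation is inhomogeneous, so the four parameters stay linearly independent: balanced
    multiples of the four unit vectors read off the coefficients. *)
Lemma root_fun_inj : injective root_fun.
Proof.
move=> [[[a b] c] d] [[[a' b'] c'] d'] /= e.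
have frac_at_int (h : {rmorphism mpoly 6 (cplx R) -> cplx R}) z : frac_at h z%:~R z%:~R.
  by have := frac_at_tofrac h z%:~R; rewrite !rmorph_int.
have eval (p : params C) : balanced p ->
    a%:~R * al0 p + b%:~R * al1 p + c%:~R * al2 p + d%:~R * al3 p
  = a'%:~R * al0 p + b'%:~R * al1 p + c'%:~R * al2 p + d'%:~R * al3 p.
  move=> bal; pose v := Datum 0 0 0 p.
  have [_ [p0 p1 p2 p3]] := datum_at_meval (v := v) bal.
  have at_v z1 z2 z3 z4 : frac_at (meval (coords v)) (root_fun (z1, z2, z3, z4))
      (z1%:~R * al0 p + z2%:~R * al1 p + z3%:~R * al2 p + z4%:~R * al3 p).
    by do ?[apply: frac_atD | apply: frac_atM]; try exact: frac_at_int; eassumption.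
  by apply: (frac_at_unique (at_v a b c d)); rewrite /root_fun e; exact: at_v.
have two0 : (2 : C) != 0 by rewrite pnatr_eq0.
have inj z z' : z%:~R = z'%:~R :> C -> z = z' by apply: intr_inj.
have := eval (Params 1 0 0 0); have := eval (Params 0 1 0 0).
have := eval (Params 0 0 2^-1 0); have := eval (Params 0 0 0 2^-1).
rewrite /balanced /= !mulr0 !mulr1 !addr0 !add0r !mulfV //.
have half0 : (2^-1 : C) != 0 by rewrite invr_eq0.
by move=> /(_ erefl)/(mulIf half0)/inj-> /(_ erefl)/(mulIf half0)/inj->
  /(_ erefl)/inj-> /(_ erefl)/inj->.
Qed.

(** If u and w act alike, [rev w ++ u] acts trivially, hence fixes every simple root and is trivial
    in the presented group. *)
Lemma act_word_faithful u w : @act_word R u =1 @act_word R w <-> weyl_eq u w.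
Proof.
split=> [uw|]; last exact: act_word_weyl_eq.
have : weyl_eq (rev w ++ u) [::].
  apply: weyl_faithful => i; apply: root_fun_inj; rewrite -act_word_root.
  rewrite act_word_cat uw -act_word_cat.
  exact: (act_word_weyl_eq (weyl_rev_cat w)).
move/(weyl_eq_catl w); rewrite cats0 catA => /weyl_trans wu.
apply: weyl_trans (wu _ (weyl_refl _)).
exact: weyl_sym (weyl_eq_catr u (weyl_cat_rev w)).
Qed.

Lemma act_diagram :
  act (diagram R) \o act (diagram R) =1 id /\
  act (diagram R) \o act (simple R S0) =1 act (simple R S1) \o act (diagram R) /\
  act (diagram R) \o act (simple R S2) =1 act (simple R S2) \o act (diagram R) /\
  act (diagram R) \o act (simple R S3) =1 act (simple R S3) \o act (diagram R).
Proof.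
have X1 := X1_neq0 R.
split; first exact: (act_genK None).
split; first exact: (act_gens_eq (moves_diagramS0 (v := base) X1)).
split; first exact: (act_gens_eq (moves_diagramS2 (v := base) X1 (Y_neq0 R) (X1Y_A2_neq0 R))).
exact: (act_gens_eq (moves_diagramS3 (v := base) (X_neq0 R) X1)).
Qed.

End Words.

(** * Transformation of solutions *)

Local Open Scope classical_set_scope.

(** * Differentiation rules *)

Section Derivatives.
Variable K : numFieldType.
Implicit Types (f g : K -> K) (s : K).

Lemma is_derive_add f g s df dg : is_derive s (1 : K) f df -> is_derive s (1 : K) g dg ->
  is_derive s (1 : K) (fun z => f z + g z) (df + dg).
Proof. exact: is_deriveD. Qed.

Lemma is_derive_opp f s df : is_derive s (1 : K) f df ->
  is_derive s (1 : K) (fun z => - f z) (- df).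
Proof. exact: is_deriveN. Qed.

Lemma is_derive_mul f g s df dg : is_derive s (1 : K) f df -> is_derive s (1 : K) g dg ->
  is_derive s (1 : K) (fun z => f z * g z) (f s * dg + g s * df).
Proof. exact: is_deriveM. Qed.

Lemma is_derive_sub f g s df dg : is_derive s (1 : K) f df -> is_derive s (1 : K) g dg ->
  is_derive s (1 : K) (fun z => f z - g z) (df - dg).
Proof. exact: is_deriveB. Qed.

Lemma is_derive_inv f s df : is_derive s (1 : K) f df -> f s != 0 ->
  is_derive s (1 : K) (fun z => (f z)^-1) (- (f s) ^- 2 * df).
Proof. by move=> [dfs <-] fs; constructor; [exact: derivableV|exact: deriveV]. Qed.

Lemma is_derive_const (c s : K) : is_derive s (1 : K) (fun=> c) 0.
Proof. exact: is_derive_cst. Qed.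

Lemma is_derive_scale f (e s df : K) :
  is_derive (e * s) (1 : K) f df -> is_derive s (1 : K) (fun z => f (e * z)) (e * df).
Proof.
move=> [fs fdf].
have df1 : differentiable f (e *: s) by apply/derivable1_diffP.
have diff_f : is_diff (e *: s) f (fun h => h *: df).
  apply: DiffDef => //; rewrite deriv1E //; apply: funext => h.
  by rewrite derive1E fdf.
have diff_fe := is_diff_comp (is_diff_scaler e s) diff_f.
constructor; first by apply/derivable1_diffP; exact: (ex_diff (is_diff_def := diff_fe)).
rewrite [LHS](deriveE _ (ex_diff (is_diff_def := diff_fe))).
rewrite (diff_val (is_diff_def := diff_fe)) /=.
by rewrite /GRing.scale /= mulr1.
Qed.

Lemma is_derive_sqr (f : K -> K) s df : is_derive s (1 : K) f df ->
  is_derive s (1 : K) (fun z => f z ^+ 2) (2 * f s * df).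
Proof.
move=> fdf; have -> : (fun z => f z ^+ 2) = (fun z => f z * f z).
  by apply: funext => z; rewrite expr2.
by apply: (is_derive_eq (is_derive_mul fdf fdf)); ring.
Qed.

End Derivatives.

Section Flow.
Variable K : numFieldType.

(* [rhs_x] and [rhs_y] over an abstract field, so that [field] need not unfold
   the complex numbers. *)
Definition flow_x (a : params K) (x y t : K) : K :=
  (- 2 * x ^+ 3 * y + 2 * x ^+ 2 * y - (al1 a + 2 * al2 a) * x ^+ 2
   - (t - 1 + 2 * al3 a) * x + t) / t.

Definition flow_y (a : params K) (x y t : K) : K :=
  (3 * x ^+ 2 * y ^+ 2 - 2 * x * y ^+ 2 + 2 * (al1 a + 2 * al2 a) * x * y
   + (t - 1 + 2 * al3 a) * y + (al1 a + al2 a) * al2 a) / t.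

Definition time_sign (g : option node) : K :=
  match g with Some S3 | None => -1 | _ => 1 end.

Lemma ct_move g (v : datum K) : ct (move g v) = time_sign g * ct v.
Proof. by case: g => [[]|] /=; rewrite ?mul1r ?mulN1r. Qed.

Lemma time_signK g : time_sign g * time_sign g = 1.
Proof. by case: g => [[]|] /=; ring. Qed.

(** Everything is written in the new time s; as e squared is 1, the old time is e s. *)
Lemma is_derive_move g a (x y : K -> K) s (e := time_sign g)
    (v := fun z => Datum (x (e * z)) (y (e * z)) (e * z) a)
    (w := move g (v s)) :
  balanced a -> s != 0 -> regular g (v s) ->
  is_derive (e * s) (1 : K) x (flow_x a (x (e * s)) (y (e * s)) (e * s)) ->
  is_derive (e * s) (1 : K) y (flow_y a (x (e * s)) (y (e * s)) (e * s)) ->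
  is_derive s (1 : K) (fun z => cx (move g (v z))) (flow_x (cpar w) (cx w) (cy w) s) /\
  is_derive s (1 : K) (fun z => cy (move g (v z))) (flow_y (cpar w) (cx w) (cy w) s).
Proof.
case: a @v @w => a0 a1 a2 a3 v w; rewrite /balanced /= => bal s0 reg dx dy.
(* Eliminating a0 leaves rational identities in independent parameters. *)
have a0E : a0 = 1 - a1 - 2 * a2 - 2 * a3 by rewrite -[X in X - _ - _ - _]bal; ring.
have {dx} := is_derive_scale dx; have {dy} := is_derive_scale dy.
have dt : is_derive s (1 : K) (fun z => e * z) (e * 1) :=
  is_derive_scale (is_derive_id (e * s : K) (1 : K)).
subst a0; rewrite /w /v /flow_x /flow_y /= {w bal} in reg *; clear v.
have cst c := is_derive_const c s.
case: g @e reg dt => [[]|] /= reg dt dy dx; rewrite /move /=; split.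
- by apply: (is_derive_eq dx); field; rewrite ?s0 ?reg.
- by apply: (is_derive_eq (is_derive_sub dy (is_derive_mul (cst _)
    (is_derive_inv (is_derive_sub dx (cst 1)) reg)))); field; rewrite ?s0 ?reg.
- by apply: (is_derive_eq dx); field; rewrite ?s0 ?reg.
- by apply: (is_derive_eq dy); field; rewrite ?s0 ?reg.
- by apply: (is_derive_eq (is_derive_add dx (is_derive_mul (cst _) (is_derive_inv dy reg))));
    field; rewrite ?s0 ?reg.
- by apply: (is_derive_eq dy); field; rewrite ?s0 ?reg.
- by apply: (is_derive_eq dx); field; rewrite ?s0 ?reg.
- apply: (is_derive_eq (is_derive_add (is_derive_sub dy (is_derive_mul (cst _)
    (is_derive_inv dx reg))) (is_derive_mul dt (is_derive_inv (is_derive_sqr dx) _)))).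
    by rewrite expf_neq0.
  by field; rewrite ?s0 ?reg.
- by apply: (is_derive_eq (is_derive_mul dx (is_derive_inv (is_derive_sub dx (cst 1)) reg)));
    field; rewrite ?s0 ?reg.
- have dx1 := is_derive_sub dx (cst 1).
  by apply: (is_derive_eq (is_derive_mul (is_derive_opp dx1)
    (is_derive_add (is_derive_mul dx1 dy) (cst _)))); field; rewrite ?s0 ?reg.
Qed.

End Flow.

(** * Regularity and the Baecklund property *)

Section Backlund.
Variable R : realType.
Notation C := (cplx R).

(** Write n q = p d with q nonzero at v. Then n vanishes at v, and differentiating along a direction
    in which d is constant leaves q times the derivative of n equal to 0 there. *)
Lemma frac_at_pole (v : 'I_6 -> C) (n d : mpoly 6 C) (i : 'I_6) c :
  frac_at (meval v) (tofrac n / tofrac d) c -> d != 0 -> meval v d = 0 ->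
  mderiv i d = 0 -> meval v (mderiv i n) = 0.
Proof.
move=> [p [q [e vq _]]] d0 vd id.
have q0 : q != 0 := rmorph_neq0 vq.
have {}e : n * q = p * d.
  by move/eqP: e; rewrite eqr_div ?tofrac_eq0 // -!rmorphM tofrac_eq => /eqP.
have vn : meval v n = 0.
  have /eqP := congr1 (meval v) e; rewrite !mevalM vd mulr0 mulf_eq0 (negPf vq) orbF.
  by move/eqP.
have /eqP := congr1 (meval v \o mderiv i) e.
by rewrite /= !mderivM id mulr0 addr0 !mevalD !mevalM vn vd mul0r addr0 mulr0 mulf_eq0
  (negPf vq) orbF => /eqP.
Qed.

Lemma mderivXU (i j : 'I_6) :
  mderiv i (mpolyX C (mnm1 j)) = ((j == i)%:R : mpoly 6 C).
Proof.
rewrite mderivX mnm1E; case: eqVneq => [->|_]; last by rewrite scale0r.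
by rewrite -[X in mnm_sub X _]add0m addmK mpolyX0 scale1r.
Qed.

(* When numerator and denominator of the translation term both vanish, its
   value is still undefined: a parameter derivative of the numerator is not 0. *)
Lemma value_regular g (v w : datum C) : balanced (cpar v) -> ct v != 0 ->
  datum_at (meval (coords v)) (gen R g) w -> regular g v.
Proof.
move=> bal t0 [[fx fy _] _].
have [[bx by_ bt] [b0 b1 b2 b3]] := datum_at_meval bal.
have one := frac_at_nat (meval (coords v)) 1.
have two := frac_at_nat (meval (coords v)) 2.
pose Z k : mpoly 6 C := mpolyX C (mnm1 (inord k)).
have hZ k : meval (coords v) (Z k) = coords v (inord k) := mevalXU _ _.
have dZ k l : (k < 6)%N -> (l < 6)%N -> mderiv (inord k) (Z l) = (l == k)%:R.
  by move=> k6 l6; rewrite mderivXU -val_eqE /= !inordK.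
have d1 i : mderiv i (1 : mpoly 6 C) = 0 by rewrite -mpolyC1 mderivC.
have d2 i : mderiv i (2 : mpoly 6 C) = 0 by rewrite mderivMn d1 mul0rn.
have pole_X1 n k c : frac_at (meval (coords v)) (tofrac n / (X R - 1)) c -> (0 < k < 6)%N ->
    meval (coords v) (mderiv (inord k) n) != 0 -> cx v - 1 != 0.
  move=> fc /andP[k0 k6]; apply: contra_neq => x1.
  have e : X R - 1 = tofrac (Z 0 - 1) by rewrite rmorphB rmorph1.
  apply: (frac_at_pole (d := Z 0 - 1) (c := c)).
  - by rewrite -e.
  - by rewrite -tofrac_eq0 -e X1_neq0.
  - by rewrite mevalB meval1 hZ /coords inordK.
  - by rewrite mderivB dZ // d1 subr0; case: k k0 {k6}.
case: g fx fy => [[]|] /= fx fy.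
(* Subtracting from y isolates a0/(x-1), whose numerator has derivative -1 in alpha_1, the variable
   of index 3. *)
- have := frac_atB by_ fy; rewrite opprB addrC subrK.
  have -> : A0 R = tofrac (1 - Z 3 - 2 * Z 4 - 2 * Z 5).
    by rewrite !rmorphB !rmorphM !rmorph_nat rmorph1.
  move/pole_X1 => /(_ 3) -> //.
  rewrite !mderivB !mderivM !dZ // d1 d2 /= !mul0r !mulr0 !addr0 !subr0 sub0r.
  by rewrite mevalN meval1 oppr_eq0 oner_neq0.
- by [].
- have := frac_atB fx bx; rewrite [_ + A2 R / _]addrC addrK => fc.
  apply/eqP => y0.
  have := frac_at_pole (n := Z 4) (d := Z 1) (i := inord 4) fc.
  rewrite !dZ // hZ /coords inordK //= -tofrac_eq0 => /(_ (Y_neq0 R) y0 erefl)/eqP.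
  by rewrite meval1 oner_eq0.
(* Multiplying y' - y by x^2 gives t - 2 a3 x: at x = 0 this would have both the value 0 and the
   nonzero value t. *)
- apply/eqP => x0; have := frac_atM (frac_atB fy by_) (frac_atX 2 bx).
  have cancel_poles (K : fieldType) (x y t a : K) : x != 0 ->
      (y - 2 * a / x + t / x ^+ 2 - y) * x ^+ 2 = t - 2 * a * x by move=> ?; field.
  rewrite cancel_poles ?X_neq0 //.
  rewrite /= x0 expr0n mulr0 => /frac_at_unique.
  move=> /(_ _ (frac_atB bt (frac_atM (frac_atM two b3) bx)))/esym/eqP.
  by rewrite /= x0 mulr0 subr0 (negPf t0).
(* The identity x' (x - 1) = x would force x = 0 at x = 1. *)
- apply/eqP => x1; have := frac_atM fx (frac_atB bx one).
  rewrite /= divfK ?X1_neq0 // x1 mulr0 => /(frac_at_unique bx) /= x0.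
  by move/eqP: x1; rewrite x0 sub0r oppr_eq0 oner_eq0.
Qed.

End Backlund.

Lemma open_scale (K : numFieldType) (e : K) (W : set K) :
  open W -> open [set s | W (e * s)].
Proof. by move=> oW; apply: open_comp oW => s _; exact: mulrl_continuous. Qed.

Lemma backlund_gen (R : realType) g : backlund (gen R g).
Proof.
move=> a U x y [bal oU U0 sol] W oW [t1 Wt1] WU a' theta xi eta maps.
pose e := time_sign (cplx R) g.
have maps_move t : W t -> regular g (Datum (x t) (y t) t a) /\
    Datum (xi (theta t)) (eta (theta t)) (theta t) a' = move g (Datum (x t) (y t) t a).
  move=> Wt; set v := Datum (x t) (y t) t a.
  have gv : datum_at (meval (coords v)) (gen R g)
      (Datum (xi (theta t)) (eta (theta t)) (theta t) a').
    exact: maps.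
  have reg : regular g v by apply: (value_regular _ _ gv) => //; exact/U0/WU.
  split=> //; apply: (datum_at_unique gv).
  by rewrite genE; apply: datum_at_move reg; exact: datum_at_meval.
have thetaE t : W t -> theta t = e * t.
  by move=> /maps_move[_ /(congr1 (@ct _))]; rewrite ct_move.
have eK s : e * (e * s) = s by rewrite mulrA time_signK mul1r.
(* Multiplication by e is its own inverse, so the image is a preimage, hence open. *)
have imW : theta @` W = [set s | W (e * s)].
  rewrite eqEsubset; split=> [_ [t Wt <-]|s Wes]; first by rewrite /= thetaE // eK.
  by exists (e * s); rewrite // thetaE // eK.
rewrite imW; split.
- have [_ /(congr1 (@cpar _)) /= ->] := maps_move _ Wt1.
  exact: move_balanced.
- exact: open_scale.
- by move=> s /WU /U0; apply: contra_neq => ->; rewrite mulr0.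
move=> s Wes; pose v z := Datum (x (e * z)) (y (e * z)) (e * z) a.
have at_move z : W (e * z) -> Datum (xi z) (eta z) z a' = move g (v z).
  by move=> Wez; have [_] := maps_move _ Wez; rewrite thetaE // eK.
have [reg _] := maps_move _ Wes.
have s0 : s != 0 by have := U0 _ (WU _ Wes); apply: contra_neq => ->; rewrite mulr0.
have [dx dy] := sol _ (WU _ Wes).
have [dxi deta] := is_derive_move bal s0 reg dx dy.
(* Agreement on a neighbourhood, not only at s, is what transfers the derivatives to [xi] and
   [eta]. *)
have near_at_move : \near s, Datum (xi s) (eta s) s a' = move g (v s).
  have : nbhs s [set z | W (e * z)] by apply: open_nbhs_nbhs; split=> //; exact: open_scale.
  by apply: filterS => z /at_move.
have e' := at_move _ Wes; rewrite -/(v s) -e' in dxi deta.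
split.
  apply: near_eq_is_derive dxi; apply: filterS near_at_move => z.
  by move/(congr1 (@cx _)).
apply: near_eq_is_derive deta; apply: filterS near_at_move => z.
by move/(congr1 (@cy _)).
Qed.

Theorem theorem1p1 (R : realType) :
  ((forall i : node, backlund (simple R i)) /\ backlund (diagram R)) /\
  ((forall i : node, is_automorphism (simple R i)) /\
   is_automorphism (diagram R)) /\
  (forall u v : seq node,
     (forall f : ratfun R, act_word u f = act_word v f) <-> weyl_eq u v) /\
  (act (diagram R) \o act (diagram R) =1 id /\
   act (diagram R) \o act (simple R S0) =1 act (simple R S1) \o act (diagram R) /\
   act (diagram R) \o act (simple R S2) =1 act (simple R S2) \o act (diagram R) /\
   act (diagram R) \o act (simple R S3) =1 act (simple R S3) \o act (diagram R)).
Proof.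
split; first by split=> [i|]; [exact (@backlund_gen R (Some i))|exact (@backlund_gen R None)].
split; first by split=> [i|];
  [exact: (act_gen_automorphism R (Some i))|exact: (act_gen_automorphism R None)].
by split; [exact: act_word_faithful|exact: act_diagram].
Qed.
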